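(* The Diophantine equation $$x^2+(x+1)^2=w^4$$ has exactly two solutions $(x,w)$ in non-negative integers $x,w$, namely $(x,w)=(0,1)$ and $(x,w)=(119,13)$. *)

(* Defs.v *)
From mathcomp Require Import all_boot.

(* Main.v *)
(* With X = 2 x + 1 the equation reads X ^ 2 + 1 = 2 w ^ 4. Parametrising
   Pythagorean triples twice yields a Gaussian integer z of norm w with
   z ^ 4 = - x + (x + 1) i for odd x and z ^ 4 = (x + 1) - x i for even x.
   Compare it with 3 + 2 i, which belongs to x = 119: up to a power of i, and
   up to a factor (1 + i) / sqrt 2 if x is even, z (3 - 2 i) has argument
   delta - eps (x odd) or delta + eps (x even), where delta = atan (1/239) / 4
   and eps = atan (1/X) / 4 is tiny.

   By Thue's method such an approximation of e ^ (i delta) is too good. The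
   integral of (2 cos 4 delta - 2 cos 4 t) ^ r cos t over [0, delta] is very
   small; expanding the integrand turns it into a trigonometric sum in delta
   with rational coefficients (diagonal Pade approximants of the fourth root
   at (239 + i) / (239 - i)). Replacing e ^ (i delta) by z (3 - 2 i) and
   clearing denominators gives a rational integer. The sign of the integral is
   (-1) ^ r, so this integer is nonzero when r has the parity of x, and it is
   less than 1 in absolute value as soon as 26 w < 42 ^ (2 r) and
   208 * 5408 ^ (2 r) <= w ^ 3. For r >= 12 these ranges cover all large w.

   For the small values, (X, w ^ 2) solves the negative Pell equation, and
   among its first 100 solutions only those with X = 1 and X = 239 have a
   square second component. *)
From Stdlib Require Import ZArith Lia.
From mathcomp Require Import all_boot all_order all_algebra.
From mathcomp Require Import complex Rstruct.
From mathcomp Require Import all_classical all_reals all_analysis.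
From mathcomp Require Import ring lra zify.
Require Import Defs.
Import Order.TTheory GRing.Theory Num.Theory.
Import numFieldNormedType.Exports.
Set Implicit Arguments.
Unset Strict Implicit.
Unset Printing Implicit Defensive.

(** * The negative Pell equation and the small solutions *)

Section Pell.
Local Open Scope Z_scope.

(** Multiplication of X + Y sqrt 2 by the unit 3 + 2 sqrt 2. *)
Definition pell_step (p : Z * Z) : Z * Z :=
  (3 * p.1 + 4 * p.2, 2 * p.1 + 3 * p.2).

Definition pell (k : nat) : Z * Z := iter k pell_step (1, 1).

(** Descent: division by 3 + 2 sqrt 2 gives a solution with smaller [Y]. Its first component is
    nonnegative once [Y >= 3]; smaller values are settled directly. *)
Lemma pell_classification (X Y : Z) :
  0 <= X -> 0 < Y -> X * X + 1 = 2 * (Y * Y) -> exists k, pell k = (X, Y).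
Proof.
move=> X0 Y0; have [n] : exists n : nat, Y <= Z.of_nat n by exists (Z.to_nat Y); lia.
elim: n X Y X0 Y0 => [|n IH] X Y X0 Y0 Yn E; first by lia.
have [Y1|Y2] : Y = 1 \/ 2 <= Y by lia.
  by exists 0%nat; congr pair; nia.
have [Y3|Y3] : Y = 2 \/ 3 <= Y by lia.
  subst Y; have [X2|X3] : X <= 2 \/ 3 <= X by lia.
    by nia.
  by nia.
have [||||k Ek] := IH (3 * X - 4 * Y) (3 * Y - 2 * X).
- by nia.
- by nia.
- by nia.
- by nia.
exists k.+1; rewrite /pell iterS -/(pell k) Ek /pell_step; cbn [fst snd].
by f_equal; lia.
Qed.

Lemma pell_pos (k : nat) : 0 < (pell k).1 /\ 0 < (pell k).2.
Proof.
elim: k => [|k]; first by [].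
by rewrite /pell iterS -/(pell k) /pell_step; cbn [fst snd]; lia.
Qed.

Lemma pell_mono (k l : nat) : (k <= l)%N -> (pell k).2 <= (pell l).2.
Proof.
elim: l => [|l IH]; first by rewrite leqn0 => /eqP->; lia.
rewrite leq_eqVlt => /orP[/eqP->|]; first lia.
rewrite ltnS => /IH; have := pell_pos l; rewrite [pell l.+1]/pell iterS -/(pell l) /pell_step.
by cbn [fst snd]; lia.
Qed.

Lemma pell_square_small (k : nat) (w : Z) :
  (k < 100)%N -> 0 <= w -> (pell k).2 = w * w -> k = 0%N \/ k = 3%N.
Proof.
move=> k100 w0 E.
have /allP/(_ k) : all (fun k => (Z.sqrt (pell k).2 * Z.sqrt (pell k).2 =? (pell k).2)
    ==> (k == 0%N) || (k == 3%N)) (iota 0 100) by vm_compute.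
rewrite mem_iota k100 => /(_ isT) /implyP.
by rewrite E (Z.sqrt_square _ w0) Z.eqb_refl => /(_ isT) /orP[]/eqP; [left | right].
Qed.

Lemma pell_square_large (x w : Z) :
  0 <= x -> 0 <= w -> x ^ 2 + (x + 1) ^ 2 = w ^ 4 ->
  x = 0 \/ x = 119 \/ 1764 ^ 11 <= 26 * w.
Proof.
move=> x0 w0 E.
have w1 : 0 < w by nia.
have [|||k Ek] := @pell_classification (2 * x + 1) (w * w); [lia | nia | nia |].
have [k100|k100] := ltnP k 100.
  have Ew : (pell k).2 = w * w by rewrite Ek.
  have [k0|k3] := @pell_square_small _ _ k100 w0 Ew.
    left; move: Ek; rewrite k0 (_ : pell 0 = (1, 1)) //.
    by move=> /(f_equal fst); cbn [fst]; lia.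
  right; left; move: Ek; rewrite k3 (_ : pell 3 = (239, 169)) //.
  by move=> /(f_equal fst); cbn [fst]; lia.
right; right; have := pell_mono k100; rewrite Ek.
(* This is the claim squared: the second component is [w * w] and 676 = 26 ^ 2. *)
have : 1764 ^ 11 * 1764 ^ 11 <= (pell 100).2 * 676 by vm_compute.
move: (pell 100).2 (1764 ^ 11) => Y100 N H1 H2.
apply: Z.square_le_simpl_nonneg; [lia|].
have -> : 26 * w * (26 * w) = w * w * 676 by ring.
by move: H1 H2 => /=; lia.
Qed.

Lemma Z_of_expn (a b : nat) : Z.of_nat a ^ Z.of_nat b = Z.of_nat (a ^ b)%N.
Proof. by lia. Qed.

(* If [12 + k] is the least admissible [r], then [26 w >= 1764 ^ (10 + k)],
   which this inequality turns into the lower bound for [w ^ 3] needed at [r]. *)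
Lemma power_gap (k : nat) :
  (26 ^ 3 * (208 * (169 * 32) ^ (2 * (12 + k))) <= 1764 ^ (3 * (10 + k)))%N.
Proof.
have step : ((169 * 32) ^ 2 <= 1764 ^ 3)%N by lia.
have mono (a b c d e f : nat) : (a * (b * c) <= d -> e <= f -> a * (b * (c * e)) <= d * f)%N.
  by move=> h1 h2; rewrite !mulnA -(mulnA a); exact: leq_mul.
elim: k => [|k IH]; first by lia.
rewrite (_ : 2 * (12 + k.+1) = 2 * (12 + k) + 2)%N; last by lia.
rewrite (_ : 3 * (10 + k.+1) = 3 * (10 + k) + 3)%N; last by lia.
by rewrite (expnD _ _ 2) (expnD _ _ 3); exact: mono.
Qed.

Lemma nontrivial_solution_large (x w : nat) : (x ^ 2 + (x + 1) ^ 2 = w ^ 4)%N ->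
  x <> 0%N -> x <> 119%N -> (1764 ^ 11 <= 26 * w)%N.
Proof.
move=> E x0 x119.
have E1 : Z.of_nat x ^ 2 + (Z.of_nat x + 1) ^ 2 = Z.of_nat w ^ 4 by lia.
have [||?|[?|W]] := pell_square_large _ _ E1; [lia| lia | lia | lia | ].
have W1 : Z.of_nat 1764 ^ Z.of_nat 11 <= 26 * Z.of_nat w by [].
by rewrite Z_of_expn in W1; move: (1764 ^ 11)%N W1 => N; lia.
Qed.
End Pell.

(** * Pythagorean triples and a Gaussian fourth root *)

Lemma coprime_mul_square (u v s : nat) : 0 < u ->
  coprime u v -> u * v = s ^ 2 -> exists g, u = g ^ 2.
Proof.
move=> u0 cuv E; set g := gcdn u s; exists g.
have g0 : 0 < g by rewrite gcdn_gt0 u0.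
have [u' Eu] : exists u', u = u' * g by apply/dvdnP/dvdn_gcdl.
have [s' Es] : exists s', s = s' * g by apply/dvdnP/dvdn_gcdr.
have cus : coprime u' s'.
  by rewrite /coprime -(eqn_pmul2r g0) muln_gcdl -Eu -Es mul1n.
have E1 : u' * v = g * s' ^ 2.
  by apply/eqP; rewrite -(eqn_pmul2r g0); apply/eqP; nia.
(* [u'] is coprime to [s'] and [g] to [v], so in [u' * v = g * s' ^ 2] each of [u'] and [g] divides
   the other. *)
have d1 : u' %| g.
  rewrite -(@Gauss_dvdl _ _ (s' ^ 2)); last by rewrite coprimeXr.
  by rewrite -E1 dvdn_mulr.
have d2 : g %| u'.
  rewrite -(@Gauss_dvdl _ _ v); last by apply: coprime_dvdl cuv; rewrite dvdn_gcdl.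
  by rewrite E1 dvdn_mulr.
have -> : g ^ 2 = g * g by rewrite mulnn.
by rewrite {1}Eu; congr muln; apply/eqP; rewrite eqn_dvd d1 d2.
Qed.

(** The numbers (c + a) / 2 and (c - a) / 2 are coprime with product (b / 2) ^ 2, hence both are
    squares. *)
Lemma pythagorean_triple (a b c : nat) :
  coprime a b -> odd a -> ~~ odd b -> a ^ 2 + b ^ 2 = c ^ 2 ->
  exists m n, [/\ a + n ^ 2 = m ^ 2, b = 2 * m * n, c = m ^ 2 + n ^ 2 & coprime m n].
Proof.
move=> cab oa eb E.
have oc : odd c by have := congr1 odd E; rewrite oddD !oddX /= oa (negbTE eb) /=.
have cac : coprime a c.
  rewrite -(@coprime_pexpr 2) // -E /coprime -[a ^ 2]mulnn gcdnMDl.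
  exact: coprimeXr.
have ac : a <= c by rewrite -(@leq_exp2r _ _ 2) // -E leq_addr.
have [u Eu] : exists u, c + a = 2 * u by exists ((c + a) %/ 2); lia.
have [v Ev] : exists v, c = a + 2 * v by exists ((c - a) %/ 2); lia.
have [s Es] : exists s, b = 2 * s by exists (b %/ 2); lia.
have Ec : c = u + v by lia.
have Ea : u = a + v by lia.
have cuv : coprime u v.
  rewrite /coprime -dvdn1 -(eqP cac) dvdn_gcd.
  have [d1 d2] : gcdn u v %| u /\ gcdn u v %| v by rewrite dvdn_gcdl dvdn_gcdr.
  by rewrite -(dvdn_addl _ d2) -Ea d1 Ec dvdn_add.
have Euv : u * v = s ^ 2 by subst b c u; nia.
have a0 : 0 < a by case: (a) oa.
have u0 : 0 < u by lia.
have [m Em] := coprime_mul_square u0 cuv Euv.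
have [n En] : exists n, v = n ^ 2.
  (* [b = 0] is allowed and gives [v = 0], where [coprime_mul_square] does not apply. *)
  have [v0|v0] := posnP v; first by exists 0; rewrite v0.
  by apply: (@coprime_mul_square v u s) => //; rewrite 1?coprime_sym // mulnC.
exists m, n; split; [lia| | lia |].
  by rewrite Es -mulnA; congr muln; move: Euv; rewrite Em En -expnMn => /eqP;
     rewrite eqn_exp2r // => /eqP.
by move: cuv; rewrite Em En coprime_pexpl // coprime_pexpr.
Qed.

(** The left sides are the real and imaginary parts of (p + q i) ^ 4. A first parametrisation gives
    w ^ 2 = m ^ 2 + n ^ 2; a second one makes n + m i (odd [x]) or m - n i (even [x]) a square. *)
Lemma gaussian_fourth_root (x w : nat) : x ^ 2 + (x + 1) ^ 2 = w ^ 4 ->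
  exists p q : int,
    (p ^+ 4 - 6 * p ^+ 2 * q ^+ 2 + q ^+ 4 = if odd x then - x%:Z else x%:Z + 1)%R /\
    (4 * (p ^+ 3 * q - p * q ^+ 3) = if odd x then x%:Z + 1 else - x%:Z)%R.
Proof.
move=> E.
have cx : coprime x (x + 1) by rewrite addn1 coprimenS.
have E2 : x ^ 2 + (x + 1) ^ 2 = (w ^ 2) ^ 2 by rewrite -expnM.
case: ifP => ox.
  have ex1 : ~~ odd (x + 1) by rewrite addn1 /= ox.
  have [m [n [E3 E4 E5 cmn]]] := pythagorean_triple cx ox ex1 E2.
  (* Modulo 4: if [m] were odd, [n] would be even, so x = m ^ 2 - n ^ 2 would be 1 while x + 1 = 2 m
     n would be 0. *)
  have om : ~~ odd m.
    apply/negP => om; have := congr1 odd E3; rewrite oddD !oddX /= om ox /=.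
    case on: (odd n) => // _.
    have [k Ek] : exists k, n = 2 * k by exists (n %/ 2); lia.
    have [l El] : exists k, m = 2 * k + 1 by exists (m %/ 2); lia.
    by subst n m; nia.
  have on : odd n.
    by have := congr1 odd E3; rewrite oddD !oddX /= (negbTE om) ox; case: odd.
  rewrite addnC in E5.
  rewrite coprime_sym in cmn.
  have [p [q [F1 F2 _ _]]] := pythagorean_triple cmn on om (esym E5).
  exists (p%:Z)%R, (q%:Z)%R.
  have Fn : (n%:Z = p%:Z ^+ 2 - q%:Z ^+ 2)%R by clear -F1; lia.
  have Fm : (m%:Z = 2 * p%:Z * q%:Z)%R by clear -F2; lia.
  have Fx : (x%:Z = m%:Z ^+ 2 - n%:Z ^+ 2)%R by clear -E3; lia.
  have Fx1 : (x%:Z + 1 = 2 * m%:Z * n%:Z)%R by clear -E4; lia.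
  by split; [rewrite Fx Fm Fn; ring | rewrite Fx1 Fm Fn; ring].
have ox1 : odd (x + 1) by rewrite addn1 /= ox.
have ex : ~~ odd x by rewrite ox.
have E2' : (x + 1) ^ 2 + x ^ 2 = (w ^ 2) ^ 2 by rewrite addnC.
have cx' : coprime (x + 1) x by rewrite coprime_sym.
have [m [n [E3 E4 E5 cmn]]] := pythagorean_triple cx' ox1 ex E2'.
have om : odd m.
  case om: (odd m) => //; have := congr1 odd E3.
  rewrite oddD !oddX /= om ox1 /=; case on: (odd n) => // _.
  have [k Ek] : exists k, m = 2 * k by exists (m %/ 2); lia.
  have [l El] : exists k, n = 2 * k + 1 by exists (n %/ 2); lia.
  by subst n m; nia.
have on : ~~ odd n.
  by have := congr1 odd E3; rewrite oddD !oddX /= om ox1; case: odd.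
have [p [q [F1 F2 _ _]]] := pythagorean_triple cmn om on (esym E5).
exists (p%:Z)%R, (- q%:Z)%R.
have Fm : (m%:Z = p%:Z ^+ 2 - q%:Z ^+ 2)%R by clear -F1; lia.
have Fn : (n%:Z = 2 * p%:Z * q%:Z)%R by clear -F2; lia.
have Fx1 : (x%:Z + 1 = m%:Z ^+ 2 - n%:Z ^+ 2)%R by clear -E3; lia.
have Fx : (x%:Z = 2 * m%:Z * n%:Z)%R by clear -E4; lia.
by split; [rewrite Fx1 Fm Fn; ring | rewrite Fx Fm Fn; ring].
Qed.

(** * Factorials, arithmetic progressions and binomial bounds *)

Lemma logn2_fact_le (n : nat) : logn 2 n`! <= n.
Proof.
rewrite logn_fact //.
(* The extra term makes the induction close: it pays for the next summand and the next extra term,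
   each at most half of it. *)
suff H k : \sum_(1 <= i < k.+1) n %/ 2 ^ i + n %/ 2 ^ k <= n.
  exact: leq_trans (leq_addr _ _) (H n).
elim: k => [|k IH]; first by rewrite big_geq // divn1.
rewrite big_nat_recr //= -addnA; apply: leq_trans IH; rewrite leq_add2l.
by rewrite expnSr divnMA; lia.
Qed.

Lemma prod_shift_bin (n c : nat) : \prod_(i < n) (i + c.+1) = 'C(n + c, n) * n`!.
Proof.
rewrite bin_ffact ffact_prod (reindex_inj rev_ord_inj) /=.
by apply: eq_bigr => i _; have := ltn_ord i; lia.
Qed.

(* Modulo the odd part of [n!], the progression [4 i + c] is 4 times a run of
   consecutive integers. *)
Lemma fact_dvd_prod (n c : nat) : n`! %| 2 ^ n * \prod_(i < n) (4 * i + c).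
Proof.
have f0 := fact_gt0 n.
rewrite -{1}(partnC 2 f0) dvdn_mul //.
  by rewrite p_part dvdn_exp2l ?logn2_fact_le.
set m := n`!`_2^'.
have cm : coprime 4 m by apply: (@pnat_coprime 2) => //; apply: part_pnat.
have m0 : 0 < m by apply: part_gt0.
(* [c'.+1] represents c / 4 modulo [m]; adding [m] keeps it positive. *)
have [c' Ec'] : exists c', 4 * c'.+1 = c %[mod m].
  pose z := chinese 4 m 0 c.
  have /dvdnP[d Ed] : 4 %| z by rewrite /dvdn (chinese_modl cm).
  exists (d + m.-1); rewrite -addnS prednK // mulnDr mulnC -Ed -modnDmr modnMl addn0.
  exact: chinese_modr.
have E : \prod_(i < n) (4 * i + c) = 4 ^ n * \prod_(i < n) (i + c'.+1) %[mod m].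
  have -> : 4 ^ n = \prod_(i < n) 4 by rewrite prod_nat_const card_ord.
  rewrite -big_split /=.
  apply: (big_ind2 (fun x y => x = y %[mod m])) => // [x1 x2 y1 y2 E1 E2|i _].
    by rewrite -modnMm E1 E2 modnMm.
  by rewrite mulnDr -modnDmr -Ec' modnDmr.
rewrite /dvdn E -/(dvdn _ _) prod_shift_bin mulnA dvdn_mull //.
exact: dvdn_part.
Qed.

Lemma prod_le_prod (n : nat) (F G : nat -> nat) :
  (forall i, F i <= G i) -> \prod_(i < n) F i <= \prod_(i < n) G i.
Proof. by move=> H; elim/big_ind2: _ => // *; apply: leq_mul. Qed.

(** Bounding 4 i + c by 4 (i + d + 1) leaves [4 ^ n] times a run of consecutive integers, whose
    quotient by n! is a binomial coefficient. *)
Lemma progression_quotient (n c d : nat) : c <= 4 * d.+1 ->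
  exists2 k, k * n`! = 2 ^ n * \prod_(i < n) (4 * i + c) & k <= 8 ^ n * 'C(n + d, n).
Proof.
move=> cd; have /dvdnP[k Ek] := fact_dvd_prod n c; exists k => //.
rewrite -(leq_pmul2r (fact_gt0 n)) -Ek -mulnA -prod_shift_bin.
rewrite (_ : 8 = 2 * 4) // expnMn -mulnA leq_mul2l expn_eq0 /=.
have -> : 4 ^ n = \prod_(i < n) 4 by rewrite prod_nat_const card_ord.
rewrite -big_split /=.
by apply: (@prod_le_prod n (fun i => 4 * i + c) (fun i => 4 * (i + d.+1))) => i; lia.
Qed.

Lemma sum_bin (n : nat) : \sum_(i < n.+1) 'C(n, i) = 2 ^ n.
Proof. by rewrite (expnDn 1 1); apply: eq_bigr => i _; rewrite !exp1n !muln1. Qed.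

Lemma bin_le_exp2 (n k : nat) : 'C(n, k) <= 2 ^ n.
Proof.
have [kn|kn] := ltnP n k; first by rewrite bin_small.
by rewrite -sum_bin (bigD1 (Ordinal (kn : k < n.+1))) //= leq_addr.
Qed.

Lemma sum_bin_mul_le (r : nat) :
  \sum_(a < r.+1) 'C(r.+1, a) * 'C(r, a) <= 2 * 4 ^ r.
Proof.
apply: (@leq_trans (\sum_(a < r.+1) 'C(r.+1, a) * 2 ^ r)).
  by apply: leq_sum => a _; rewrite leq_mul2l bin_le_exp2 orbT.
rewrite -big_distrl /= (_ : 4 = 2 * 2) // expnMn mulnA leq_mul2r.
by rewrite -expnS -(sum_bin r.+1) [leqRHS]big_ord_recr /= leq_addr orbT.
Qed.

(** * Pade coefficients and their common denominator *)

Section Pade.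
Local Open Scope ring_scope.
Variable R : realFieldType.

(** By Pascal's rule the sum for r + 1 is the difference of the sums for r at [x] and at x + 4. *)
Lemma sum_bin_partial_fractions (r : nat) (x : R) :
  (forall j : nat, x + 4 * j%:R != 0) ->
  \sum_(b < r.+1) (-1) ^+ b * 'C(r, b)%:R / (x + 4 * b%:R) =
  4 ^+ r * r`!%:R / \prod_(j < r.+1) (x + 4 * j%:R).
Proof.
elim: r x => [|r IH] x x0.
  by rewrite !big_ord1 !mulr1 /= ?bin0 ?expr0 ?mulr1.
have x0' (j : nat) : x + 4 + 4 * j%:R != 0.
  by rewrite (_ : _ + _ = x + 4 * j.+1%:R) //; ring.
have -> : \sum_(b < r.+2) (-1) ^+ b * 'C(r.+1, b)%:R / (x + 4 * b%:R) =
  \sum_(b < r.+1) (-1) ^+ b * 'C(r, b)%:R / (x + 4 * b%:R) -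
  \sum_(b < r.+1) (-1) ^+ b * 'C(r, b)%:R / (x + 4 + 4 * b%:R).
  rewrite big_ord_recl /= [in RHS]big_ord_recl /= -addrA; congr (_ + _).
    by rewrite !bin0.
  have -> : \sum_(i < r) (-1) ^+ bump 0 i * 'C(r, bump 0 i)%:R / (x + 4 * (bump 0 i)%:R)
     = \sum_(i < r.+1) (-1) ^+ i.+1 * 'C(r, i.+1)%:R / (x + 4 * i.+1%:R) :> R.
    by rewrite [RHS]big_ord_recr /= bin_small // mulr0 mul0r addr0.
  rewrite -sumrB; apply: eq_bigr => i _; rewrite /bump /= add1n binS natrD exprS.
  by rewrite (_ : x + 4 + 4 * i%:R = x + 4 * i.+1%:R); ring.
rewrite !IH // big_ord_recl [in X in _ - X]big_ord_recr [in RHS]big_ord_recl.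
rewrite [X in _ = _ / (_ * X)]big_ord_recr /=.
have P0 : \prod_(i < r) (x + 4 * (bump 0 i)%:R) != 0 by apply/prodf_neq0 => i _; apply: x0.
have -> : \prod_(i < r) (x + 4 + 4 * i%:R) = \prod_(i < r) (x + 4 * (bump 0 i)%:R).
  by apply: eq_bigr => i _; rewrite /bump add1n; ring.
move: P0; set P := \prod_(i < r) _ => P0.
rewrite mulr0 addr0 /bump add1n factS natrM exprS.
have := x0 0%N; have := x0 r.+1; rewrite mulr0 addr0 => h1 h2.
by field; rewrite h2 P0 nat1r h1.
Qed.

(** Termwise integration of the kernel gives a double sum over a and b; at the endpoint delta the
    angle depends on a only, and this is its coefficient. *)
Definition pade (r a : nat) : R :=
  \sum_(b < r.+1) (-1) ^+ (a + b) * ('C(r, a) * 'C(r, b))%:R / (4 * (b%:R - a%:R) + 1).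

Lemma progression_neq0 (a j : nat) : 1 - 4 * a%:R + 4 * j%:R != 0 :> R.
Proof.
have -> : 1 - 4 * a%:R + 4 * j%:R = (1 - 4 * a%:Z + 4 * j%:Z)%:~R :> R.
  by rewrite !rmorphD rmorphN !rmorphM.
by rewrite intr_eq0; lia.
Qed.

(** Partial fractions at x = 1 - 4 a. The first a factors of the denominator are -(4 i + 3), and
    their signs cancel [(-1) ^+ a]. *)
Lemma padeE (r a : nat) : (a <= r)%N ->
  pade r a = 'C(r, a)%:R * 4 ^+ r * r`!%:R /
    ((\prod_(i < a) (4 * i + 3)) * (\prod_(i < (r - a).+1) (4 * i + 1)))%:R.
Proof.
move=> ar.
have -> : pade r a = (-1) ^+ a * 'C(r, a)%:R * (\sum_(b < r.+1)
    (-1) ^+ b * 'C(r, b)%:R / (1 - 4 * a%:R + 4 * b%:R)).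
  rewrite mulr_sumr; apply: eq_bigr => b _; rewrite exprD natrM.
  by rewrite (_ : 4 * (b%:R - a%:R) + 1 = 1 - 4 * a%:R + 4 * b%:R :> R); ring.
rewrite sum_bin_partial_fractions; last exact: progression_neq0.
have -> : \prod_(j < r.+1) (1 - 4 * a%:R + 4 * j%:R) = (-1) ^+ a *
    ((\prod_(i < a) (4 * i + 3)) * (\prod_(i < (r - a).+1) (4 * i + 1)))%:R :> R.
  rewrite -(big_mkord xpredT (fun j => 1 - 4 * a%:R + 4 * j%:R)).
  rewrite (@big_cat_nat _ _ _ a) //=; last by rewrite ltnW.
  rewrite natrM mulrA; congr (_ * _).
    rewrite big_mkord (reindex_inj rev_ord_inj) /= natr_prod -[X in (-1) ^+ X](card_ord a).
    rewrite -prodr_const -big_split /=; apply: eq_bigr => i _.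
    by rewrite natrB // natrD natrM -natr1; ring.
  rewrite -{1}[a]add0n big_addn big_mkord subSn // natr_prod; apply: eq_bigr => i _.
  by rewrite natrD; ring.
rewrite invfM invr_sign; set q := _%:R^-1.
transitivity (((-1) ^+ a) ^+ 2 * ('C(r, a)%:R * 4 ^+ r * r`!%:R * q)); first ring.
by rewrite sqrr_sign mul1r.
Qed.

Lemma pade_integral (r : nat) : exists2 N : R,
  0 < N <= 8 ^+ r & forall a, (a <= r)%N -> exists2 k,
  N * pade r a = k%:R & (k <= 8 ^ r * ('C(r.+1, a) * 'C(r, a)))%N.
Proof.
pose P1 n := (\prod_(i < n) (4 * i + 1))%N.
pose P3 n := (\prod_(i < n) (4 * i + 3))%N.
have P10 n : (0 < P1 n)%N by apply: prodn_gt0 => i; rewrite addn1.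
have P30 n : (0 < P3 n)%N by apply: prodn_gt0 => i; rewrite addn3.
exists ((P1 r.+1 * P3 r)%:R / (2 ^ r * r`! ^ 2)%:R).
  have D0 : (0 < 2 ^ r * r`! ^ 2)%N by rewrite muln_gt0 !expn_gt0 fact_gt0.
  apply/andP; split.
    by apply: divr_gt0; rewrite ltr0n // muln_gt0 P10 P30.
  rewrite ler_pdivrMr ?ltr0n //.
  rewrite -natrX -natrM ler_nat mulnA -expnMn /P1 /P3 big_ord_recl mul1n -big_split /=.
  elim: r {D0} => [|r IH]; first by rewrite big_ord0.
  have H : ((4 * bump 0 r + 1) * (4 * r + 3) <= 16 * r.+1 ^ 2)%N by rewrite /bump; nia.
  rewrite big_ord_recr /=; apply: (leq_trans (leq_mul IH H)).
  by rewrite factS [(_ ^ r.+1)%N]expnS -!mulnn; move: (_ ^ r)%N (r`!) (r.+1) => x y z; lia.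
move=> a ar.
have [|k1 E1 B1] := @progression_quotient a (4 * (r - a) + 5) (r - a).+1; first by lia.
have [|k2 E2 B2] := @progression_quotient (r - a) (4 * a + 3) a; first by lia.
exists (k1 * k2)%N; last first.
  rewrite -{1}(subnKC ar) expnD mulnACA; apply: (leq_trans (leq_mul B1 B2)).
  by rewrite addnS subnKC // subnK // bin_sub.
rewrite padeE // -/(P1 _) -/(P3 _).
have -> : P1 r.+1 = (P1 (r - a).+1 * \prod_(i < a) (4 * i + (4 * (r - a) + 5)))%N.
  rewrite /P1 -(big_mkord xpredT (fun i => 4 * i + 1)%N).
  rewrite (@big_cat_nat _ _ _ (r - a).+1) //=; last by rewrite ltnS leq_subr.
  rewrite big_mkord; congr muln.
  rewrite -{1}[(r - a).+1]add0n big_addn subSS subKn // big_mkord.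
  by apply: eq_bigr => i _; lia.
have -> : P3 r = (P3 a * \prod_(i < r - a) (4 * i + (4 * a + 3)))%N.
  rewrite /P3 -(big_mkord xpredT (fun i => 4 * i + 3)%N).
  rewrite (@big_cat_nat _ _ _ a) //= big_mkord; congr muln.
  rewrite -{1}[a]add0n big_addn big_mkord.
  by apply: eq_bigr => i _; lia.
move: (\prod_(i < a) _)%N (\prod_(i < r - a) _)%N E1 E2 (P10 (r - a).+1) (P30 a).
move: (P1 _) (P3 _) => p1 p3 q1 q3 E1 E2 p10 p30.
have Er := bin_fact ar.
have -> : (4 : R) ^+ r = (4 ^ r)%:R by rewrite natrX.
rewrite -!natrM mulf_div -!natrM.
apply: (canLR (mulfK _)); first by rewrite pnatr_eq0 -lt0n !muln_gt0 p10 p30 !expn_gt0 fact_gt0.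
rewrite -natrM; congr _%:R.
have E12 : (k1 * k2 * (a`! * (r - a)`!) = 2 ^ r * (q1 * q3))%N.
  by rewrite mulnACA E1 E2 mulnACA -expnD subnKC.
have -> : (k1 * k2 * (2 ^ r * r`! ^ 2 * (p3 * p1)) =
  (k1 * k2 * (a`! * (r - a)`!)) * ('C(r, a) * 2 ^ r * r`! * (p3 * p1)))%N.
  by rewrite -mulnn -{1}Er; lia.
rewrite E12 (_ : 4 = 2 * 2)%N // expnMn; lia.
Qed.
End Pade.

(** * The complex exponential on the unit circle *)

Section Cis.
Local Open Scope ring_scope.
Variable R : realType.
Definition cis (t : R) : R[i] := (cos t +i* sin t)%C.

Lemma cisD (s t : R) : cis (s + t) = cis s * cis t.
Proof. by apply/eqP; rewrite eq_complex /= cosD sinD eqxx /= addrC. Qed.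

Lemma cis0 : cis 0 = 1.
Proof. by rewrite /cis cos0 sin0. Qed.

Lemma cis_neq0 (t : R) : cis t != 0.
Proof.
have := oner_neq0 R[i]; rewrite -cis0 -(subrr t) cisD.
by apply: contraNneq => ->; rewrite mul0r.
Qed.

Lemma cisMn (t : R) (n : nat) : cis (n%:R * t) = cis t ^+ n.
Proof.
elim: n => [|n IH]; first by rewrite mul0r cis0 expr0.
by rewrite -natr1 mulrDl mul1r cisD IH exprSr.
Qed.

Lemma Re_real_mul (c : R) (z : R[i]) : complex.Re (c%:C%C * z) = c * complex.Re z.
Proof. by case: z => x y /=; rewrite mul0r subr0. Qed.

Lemma Im_real_mul (c : R) (z : R[i]) : complex.Im (c%:C%C * z) = c * complex.Im z.
Proof. by case: z => x y /=; rewrite mul0r addr0. Qed.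
End Cis.

(** * The kernel, its primitive and the sign of its integrals *)

Section Kernel.
Local Open Scope ring_scope.
Variable R : realType.
Implicit Types (r : nat) (delta beta tau : R).

(* The primitive in [tau] of [(2 cos (4 delta) - 2 cos (4 tau)) ^+ r * cos (tau - beta)]
   obtained by termwise integration. *)
Definition pade_prim r delta beta tau : R :=
  \sum_(a < r.+1) \sum_(b < r.+1)
    (-1) ^+ (a + b) * ('C(r, a) * 'C(r, b))%:R / (4 * (b%:R - a%:R) + 1) *
    sin ((4 * (b%:R - a%:R) + 1) * tau + 4 * (r%:R - a%:R - b%:R) * delta - beta).

(** With s = e ^ (4 i delta) and t = e ^ (4 i tau), the base factors as (t - 1/s) (s/t - 1); the
    binomial theorem applies to each factor. *)
Lemma cos_kernel_expansion r delta tau :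
  ((2 * cos (4 * delta) - 2 * cos (4 * tau)) ^+ r)%:C%C =
  \sum_(a < r.+1) \sum_(b < r.+1) ((-1) ^+ (a + b) * ('C(r, a) * 'C(r, b))%:R)%:C%C *
    cis (4 * (b%:R - a%:R) * tau + 4 * (r%:R - a%:R - b%:R) * delta).
Proof.
rewrite rmorphXn /=.
have -> : (2 * cos (4 * delta) - 2 * cos (4 * tau))%:C%C =
    (cis (4 * tau) - cis (- (4 * delta))) * (cis (4 * delta - 4 * tau) - 1).
  have c2 (x : R) : (2 * cos x)%:C%C = cis x + cis (- x).
    by apply/eqP; rewrite eq_complex /= cosN sinN; apply/andP; split; apply/eqP; ring.
  rewrite rmorphB /= !c2 cisD.
  have h x : cis x * cis (- x) = 1 :> R[i] by rewrite -cisD subrr cis0.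
  have := h (4 * tau); have := h (4 * delta).
  set s := cis (4 * delta); set t := cis (4 * tau).
  set s' := cis (- (4 * delta)); set t' := cis (- (4 * tau)) => h1 h2.
  transitivity (s * (t * t') - t - (s * s') * t' + s'); last by ring.
  by rewrite h1 h2; ring.
have -> (t s u : R[i]) : ((t - s) * (u - 1)) ^+ r = \sum_(a < r.+1) \sum_(b < r.+1)
    ((-1) ^+ (a + b) * ('C(r, a) * 'C(r, b))%:R)%:C%C *
    (t ^+ (r - a) * s ^+ a * u ^+ (r - b)).
  rewrite exprMn !exprBn big_distrl /=; apply: eq_bigr => a _.
  rewrite big_distrr /=; apply: eq_bigr => b _.
  rewrite expr1n mulr1 rmorphM rmorph_nat /= rmorphXn rmorphN1 /= natrM exprD.
  by rewrite -[in LHS]mulr_natr -[X in _ * X = _]mulr_natr; ring.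
apply: eq_bigr => a _; apply: eq_bigr => b _.
have [ar br] : (a <= r)%N /\ (b <= r)%N by split; rewrite -ltnS.
by rewrite -!cisMn -!cisD !natrB //; congr (_ * cis _); ring.
Qed.

(** The integrand is the real part of the expanded kernel times [cis (tau - beta)]. The frequencies
    4 (b - a) + 1 never vanish, so termwise division is legitimate. *)
Lemma is_derive_pade_prim r delta beta tau :
  is_derive tau 1 (pade_prim r delta beta)
    ((2 * cos (4 * delta) - 2 * cos (4 * tau)) ^+ r * cos (tau - beta)).
Proof.
have D (c k d : R) : is_derive tau 1 (fun t => c / k * sin (k * t + d)) (c / k * (k * cos (k * tau + d))).
  by apply: is_derive_eq; rewrite /GRing.scale /=; ring.
pose c (a b : 'I_r.+1) : R := (-1) ^+ (a + b) * ('C(r, a) * 'C(r, b))%:R.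
pose k (a b : 'I_r.+1) : R := 4 * (b%:R - a%:R) + 1.
pose d (a b : 'I_r.+1) : R := 4 * (r%:R - a%:R - b%:R) * delta - beta.
have -> : pade_prim r delta beta = \sum_(a < r.+1) \sum_(b < r.+1)
    (fun t => c a b / k a b * sin (k a b * t + d a b)).
  rewrite fct_sumE; apply/funext => t; apply: eq_bigr => a _; rewrite fct_sumE.
  by apply: eq_bigr => b _; rewrite /d addrA.
have D1 (a : 'I_r.+1) : is_derive tau 1
    (\sum_(b < r.+1) (fun t => c a b / k a b * sin (k a b * t + d a b)))
    (\sum_(b < r.+1) c a b / k a b * (k a b * cos (k a b * tau + d a b))).
  exact: is_derive_sum.
apply: (is_derive_eq (is_derive_sum D1)) => {D D1}.
rewrite -[RHS]/(_ * complex.Re (cis (tau - beta))) -Re_real_mul cos_kernel_expansion.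
rewrite mulr_suml raddf_sum /=; apply: eq_bigr => a _.
rewrite mulr_suml raddf_sum; apply: eq_bigr => b _.
rewrite -[in RHS]mulrA -cisD -[RHS]/(complex.Re _) Re_real_mul.
rewrite -[complex.Re (cis _)]/(cos _) mulrA divfK; last first.
  by rewrite /k (_ : _ + 1 = 1 - 4 * a%:R + 4 * b%:R) ?progression_neq0 //; ring.
by congr (_ * cos _); rewrite /k /d; ring.
Qed.

(** The substitution (a, b) -> (r - b, r - a) fixes b - a and negates r - a - b. *)
Lemma pade_prim_opp r delta beta tau :
  pade_prim r delta beta (- tau) = - pade_prim r delta (- beta) tau.
Proof.
rewrite /pade_prim (reindex_inj rev_ord_inj) /= exchange_big (reindex_inj rev_ord_inj) /=.
rewrite -sumrN; apply: eq_bigr => a _; rewrite -sumrN; apply: eq_bigr => b _.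
have [ar br] : (a <= r)%N /\ (b <= r)%N by split; rewrite -ltnS.
rewrite !subSS !bin_sub // !natrB // [('C(r, b) * _)%N]mulnC.
have -> : (-1) ^+ (r - b + (r - a)) = (-1) ^+ (a + b) :> R.
  by rewrite -signr_odd -[RHS]signr_odd !oddD !oddB //; case: odd; case: odd; case: odd.
rewrite -mulrN -sinN (_ : r%:R - a%:R - (r%:R - b%:R) = b%:R - a%:R :> R); last by ring.
by congr (_ * sin _); ring.
Qed.

(** The frequency 4 (b - a) + 1 turns a shift by pi / 2 into pi / 2 plus b - a full periods. As b -
    a may be negative, a periods are added on the left and b on the right. *)
Lemma pade_prim_shift r delta beta tau :
  pade_prim r delta beta (tau + pi / 2) = pade_prim r delta (beta - pi / 2) tau.
Proof.
apply: eq_bigr => a _; apply: eq_bigr => b _; congr (_ * _).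
rewrite -(periodicn (@sinD2pi R) a) -[RHS](periodicn (@sinD2pi R) b).
by congr sin; rewrite -[pi *+ 2 *+ a]mulr_natr -[pi *+ 2 *+ b]mulr_natr; field.
Qed.

Lemma pade_prim_delta r delta beta : pade_prim r delta beta delta =
  \sum_(a < r.+1) pade R r a * sin ((4 * r%:R - 8 * a%:R + 1) * delta - beta).
Proof.
apply: eq_bigr => a _; rewrite mulr_suml; apply: eq_bigr => b _.
by congr (_ * sin _); ring.
Qed.

Lemma continuous_pade_prim r delta beta : continuous (pade_prim r delta beta).
Proof.
move=> x; apply: differentiable_continuous; apply/derivable1_diffP.
by have [] := is_derive_pade_prim r delta beta x.
Qed.

Section Angle.
Variables (delta : R).
Hypothesis delta_bounds : 0 < delta < pi / 8.

(* The substitution [t -> pi / 2 - t] of the interval [delta, pi / 2 - delta],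
   on which the kernel is positive, relates both endpoint values. *)
Lemma pade_prim_pi4_lt0 r : pade_prim r delta (pi / 4) delta < 0.
Proof.
have /andP[d0 d8] := delta_bounds; have p0 := @pi_gt0 R.
have lt : delta < pi / 2 - delta by lra.
have [c] := MVT lt (fun x _ => is_derive_pade_prim r delta (pi / 4) x)
  (continuous_subspaceT (@continuous_pade_prim r delta (pi / 4))).
rewrite in_itv /= => /andP[c1 c2].
rewrite (addrC (pi / 2)) pade_prim_shift pade_prim_opp opprB (_ : pi / 2 - pi / 4 = pi / 4); last by field.
set v := pade_prim _ _ _ _ => E.
suff : 0 < - v - v by lra.
rewrite E mulr_gt0 //; last by lra.
rewrite mulr_gt0 //; last by apply: cos_gt0_pihalf; lra.
apply: exprn_gt0; suff : cos (4 * c) < cos (4 * delta) by lra.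
(* When 4 c is at least pi, it is reflected to 2 pi - 4 c, which lies between 4 delta and pi. *)
have [c4|c4] := ltP (4 * c) pi.
  by rewrite ltr_cos ?in_itv /=; lra.
rewrite -(cosN (4 * c)) -(periodicn (@cosD2pi R) 1 (- _)) mulr1n ltr_cos ?in_itv /=; lra.
Qed.

Lemma pade_prim0 r : pade_prim r delta 0 0 = 0.
Proof. by have := pade_prim_opp r delta 0 0; rewrite !oppr0; lra. Qed.

(** The mean value theorem on [0, delta], where 0 <= cos (4 tau) - cos (4 delta) <= 1 - cos (4
    delta), so the kernel has sign [(-1) ^+ r]. *)
Lemma pade_prim_delta_bounds r :
  0 <= (-1) ^+ r * pade_prim r delta 0 delta <= delta * (2 - 2 * cos (4 * delta)) ^+ r.
Proof.
have /andP[d0 d8] := delta_bounds; have p0 := @pi_gt0 R.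
have [c] := MVT d0 (fun x _ => is_derive_pade_prim r delta 0 x)
  (continuous_subspaceT (@continuous_pade_prim r delta 0)).
rewrite in_itv /= => /andP[c1 c2]; rewrite pade_prim0 !subr0 => ->.
have cc : 0 <= cos c <= 1 by rewrite cos_le1 andbT cos_ge0_pihalf //; lra.
have c4 : cos (4 * delta) <= cos (4 * c) by apply: ltW; rewrite ltr_cos ?in_itv /=; lra.
have cle := cos_le1 (4 * c).
rewrite !mulrA -exprMn mulN1r opprB; set f := 2 * cos (4 * c) - _.
have f0 : 0 <= f by rewrite /f; lra.
have fr0 : 0 <= f ^+ r by apply: exprn_ge0.
have /andP[cc0 cc1] := cc; apply/andP; split; first by rewrite !mulr_ge0 // ltW.
rewrite [leRHS]mulrC ler_wpM2r ?(ltW d0) //; apply: (le_trans (ler_piMr fr0 cc1)).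
by apply: lerXn2r; rewrite ?nnegrE // /f; lra.
Qed.
End Angle.
End Kernel.

(** * Gaussian integers inside the complex numbers *)

Section GaussianIntegers.
Local Open Scope ring_scope.
Variable R : realType.

Definition gaussian (z : R[i]) := exists m n : int, z = (m%:~R +i* n%:~R)%C.

Lemma gaussianD (x y : R[i]) : gaussian x -> gaussian y -> gaussian (x + y).
Proof.
move=> [m [n ->]] [p [q ->]]; exists (m + p), (n + q).
by apply/eqP; rewrite eq_complex /= !rmorphD !eqxx.
Qed.

Lemma gaussianM (x y : R[i]) : gaussian x -> gaussian y -> gaussian (x * y).
Proof.
move=> [m [n ->]] [p [q ->]]; exists (m * p - n * q), (m * q + n * p).
by apply/eqP; rewrite eq_complex /= rmorphB rmorphD !rmorphM !eqxx.
Qed.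

Lemma gaussian_int (m n : int) : gaussian (m%:~R +i* n%:~R)%C.
Proof. by exists m, n. Qed.

Lemma gaussian_nat (k : nat) : gaussian (k%:R)%:C%C.
Proof. by exists k%:Z, 0; rewrite /real_complex_def. Qed.

Lemma gaussianX (x : R[i]) (k : nat) : gaussian x -> gaussian (x ^+ k).
Proof.
move=> gx; elim: k => [|k IH]; last by rewrite exprS; apply: gaussianM.
by exists 1, 0; apply/eqP; rewrite expr0 eq_complex /= !eqxx.
Qed.

Lemma gaussian_sum (I : finType) (F : I -> R[i]) :
  (forall i, gaussian (F i)) -> gaussian (\sum_i F i).
Proof.
move=> gF; elim/big_ind: _ => //; last exact: gaussianD.
by exists 0, 0.
Qed.

Lemma gaussian_i : gaussian 'i%C.
Proof. by exists 0, 1. Qed.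

Lemma gaussianN (x : R[i]) : gaussian x -> gaussian (- x).
Proof. by move=> [m [n ->]]; exists (- m), (- n); rewrite !rmorphN. Qed.

(** [y] is [z] times a power of i; which one need not be known. *)
Lemma gaussian_fourth_power (y z : R[i]) : gaussian z -> y ^+ 4 = z ^+ 4 -> gaussian y.
Proof.
move=> gz E; have giz := gaussianM gaussian_i gz.
have : (y - z) * (y + z) * ((y - 'i%C * z) * (y + 'i%C * z)) = 0.
  transitivity (y ^+ 4 - z ^+ 4 + (1 + 'i%C * 'i%C) * (z ^+ 4 - y ^+ 2 * z ^+ 2)); first by ring.
  by rewrite E subrr add0r -expr2 sqr_i subrr mul0r.
move=> /eqP; rewrite !mulf_eq0 !subr_eq0 !addr_eq0.
by case/orP => /orP[]/eqP->; rewrite ?gz ?giz //; apply: gaussianN.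
Qed.

Lemma norm_Im_gaussian (x : R[i]) : gaussian x -> complex.Im x != 0 -> 1 <= `|complex.Im x|.
Proof.
move=> [m [n ->]] /=; rewrite intr_eq0 => n0.
by rewrite -intr_norm (ler_int R 1) -gtz0_ge1 normr_gt0.
Qed.
End GaussianIntegers.

(** * The linear form at the base angle: bounds from above and below *)

Section LinearForm.
Local Open Scope ring_scope.
Variable R : realType.
Local Notation sqrt2 := (Num.sqrt 2 : R).

Definition base_angle : R := atan 239^-1 / 4.
Definition omega8 : R[i] := (sqrt2^-1 +i* sqrt2^-1)%C.

Lemma sqrt2_gt0 : 0 < sqrt2. Proof. by rewrite sqrtr_gt0. Qed.

Lemma sqrt2_sqr : sqrt2 ^+ 2 = 2. Proof. by rewrite sqr_sqrtr. Qed.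

Lemma omega8_sqr : omega8 ^+ 2 = 'i%C.
Proof.
have s0 := sqrt2_gt0; have s2 := sqrt2_sqr.
apply/eqP; rewrite expr2 eq_complex /= subrr eqxx /=; apply/eqP.
transitivity (2 * (sqrt2 ^+ 2)^-1); first by field; lra.
by rewrite s2 divff.
Qed.

Lemma sqrt2_omega8 : sqrt2%:C%C * omega8 = (1 +i* 1)%C.
Proof.
have s0 := sqrt2_gt0.
by apply/eqP; rewrite eq_complex /= !mul0r subr0 addr0 divff ?eqxx //; lra.
Qed.

Lemma cis_atan (x : R) : 0 < x ->
  (Num.sqrt (x ^+ 2 + 1))%:C%C * cis (atan x^-1) = (x +i* 1)%C.
Proof.
move=> x0; have c0 : 0 < cos (atan x^-1).
  by apply: cos_gt0_pihalf; rewrite atan_gtNpi2 atan_ltpi2.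
have := atanK x^-1; rewrite /tan; set c := cos _ in c0 *; set s := sin _ => E.
have Es : s * x = c by rewrite -[s](@divfK _ c) ?gt_eqF // E; field; lra.
have E1 : (x ^+ 2 + 1) * s ^+ 2 = 1.
  by rewrite -[RHS](cos2Dsin2 (atan x^-1)) -/c -/s -Es; ring.
have s0 : 0 < s by rewrite -(pmulr_lgt0 _ x0) Es.
have E2 : Num.sqrt (x ^+ 2 + 1) * s = 1.
  apply: (@pexpIrn _ 2) => //; rewrite ?nnegrE ?mulr_ge0 ?sqrtr_ge0 ?ltW //.
  by rewrite exprMn sqr_sqrtr ?E1 ?expr1n //; have := sqr_ge0 x; lra.
apply/eqP; rewrite eq_complex /= -/c -/s !mul0r subr0 addr0 E2 eqxx andbT -Es.
by rewrite mulrA E2 mul1r.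
Qed.

Lemma base_angle_bounds : 0 < base_angle < pi / 8.
Proof.
have := @atan_ltpi2 R 239^-1; have := @lt_atan R 0 239^-1; rewrite atan0 invr_gt0.
by rewrite /base_angle => /(_ ltac:(lra)); lra.
Qed.

Lemma cis_base_angle : (169 * sqrt2)%:C%C * cis (4 * base_angle) = (239 +i* 1)%C.
Proof.
rewrite -cis_atan ?ltr0n // /base_angle; congr (_%:C%C * cis _); last by field.
apply: (@pexpIrn _ 2) => //; rewrite ?nnegrE ?mulr_ge0 ?sqrtr_ge0 //.
by rewrite exprMn !sqr_sqrtr //; lra.
Qed.

Let z169 : R[i] := (120 +i* -119)%C.
Let z169' : R[i] := (120 +i* 119)%C.

(** 239 + i = (1 + i) (120 - 119 i). *)
Lemma cis_base_angle_pos : 169%:C%C * cis (4 * base_angle) = z169 * omega8.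
Proof.
have s0 : (sqrt2%:C)%C != 0 by rewrite eq_complex /= eqxx andbT gt_eqF ?sqrt2_gt0.
apply: (mulfI s0); rewrite [RHS]mulrCA sqrt2_omega8 mulrA -rmorphM /= [_ * 169]mulrC cis_base_angle.
by apply/eqP; rewrite eq_complex /=; apply/andP; split; apply/eqP; ring.
Qed.

(** The conjugate of [omega8] is written - i [omega8], so that a product of r factors of either kind
    contains [omega8 ^+ r], whatever a is. *)
Lemma cis_base_angle_neg : 169%:C%C * cis (- (4 * base_angle)) = z169' * (- 'i%C) * omega8.
Proof.
have n0 : 169%:C%C * cis (4 * base_angle) != 0.
  by rewrite mulf_neq0 ?cis_neq0 // eq_complex /= eqxx andbT pnatr_eq0.
apply: (mulfI n0).
transitivity ((169%:C%C) ^+ 2 * (cis (4 * base_angle) * cis (- (4 * base_angle)))); first by ring.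
rewrite -cisD subrr cis0 cis_base_angle_pos.
transitivity (z169 * z169' * (- 'i%C) * omega8 ^+ 2); last by ring.
rewrite omega8_sqr.
by apply/eqP; rewrite eq_complex /=; apply/andP; split; apply/eqP; ring.
Qed.

Lemma cis_base_angle_power (r a : nat) : (a <= r)%N ->
  (169 ^+ r)%:C%C * cis ((4 * r%:R - 8 * a%:R) * base_angle) =
  z169 ^+ (r - a) * (z169' * (- 'i%C)) ^+ a * omega8 ^+ r.
Proof.
move=> ar; have -> : cis ((4 * r%:R - 8 * a%:R) * base_angle) =
    cis (4 * base_angle) ^+ (r - a) * cis (- (4 * base_angle)) ^+ a.
  by rewrite -!cisMn -cisD natrB //; congr cis; ring.
have -> : ((169 ^+ r)%:C)%C = (169%:C)%C ^+ (r - a) * (169%:C)%C ^+ a :> R[i].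
  by rewrite -exprD subnK // rmorphXn.
rewrite mulrACA -!exprMn cis_base_angle_pos cis_base_angle_neg.
have -> : omega8 ^+ r = omega8 ^+ (r - a) * omega8 ^+ a by rewrite -exprD subnK.
by rewrite !(exprMn _ _ omega8); ring.
Qed.

Lemma gaussian_term (r a : nat) (y : R[i]) : (a <= r)%N ->
  gaussian (sqrt2%:C%C * omega8 ^+ r * y) ->
  gaussian ((sqrt2 * 169 ^+ r)%:C%C * (cis ((4 * r%:R - 8 * a%:R) * base_angle) * y)).
Proof.
move=> ar gy; rewrite rmorphM /= -mulrA [_%:C%C * (_ * y)]mulrA cis_base_angle_power //.
rewrite (_ : _ * _ = z169 ^+ (r - a) * (z169' * (- 'i%C)) ^+ a * (sqrt2%:C%C * omega8 ^+ r * y)).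
  have gi := gaussianN (gaussian_i R).
  apply: gaussianM => //; apply: gaussianM; apply: gaussianX.
    by exists 120, (-119).
  by apply: gaussianM => //; exists 120, 119.
by ring.
Qed.

Lemma pade_sum_bounds (r : nat) : exists2 N : R, 0 < N <= 8 ^+ r &
  (forall a, (a <= r)%N -> exists k : nat, N * pade R r a = k%:R) /\
  \sum_(a < r.+1) N * pade R r a <= 2 * 32 ^+ r.
Proof.
have [N N8 H] := pade_integral R r; exists N => //; split.
  by move=> a /H[k E _]; exists k.
apply: (@le_trans _ _ (\sum_(a < r.+1) (8 ^ r * ('C(r.+1, a) * 'C(r, a)))%:R)).
  by apply: ler_sum => a _; have [|k ->] := H a; rewrite ?ler_nat // -ltnS.
rewrite -natr_sum -big_distrr /= -!natrX -natrM ler_nat (_ : 32 = 8 * 4)%N // expnMn.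
by rewrite mulnCA leq_mul2l sum_bin_mul_le orbT.
Qed.

Local Notation form r beta := (pade_prim r base_angle beta base_angle).

(** [form r 0] is the sine sum and [form r (pi / 2)] is minus the cosine sum. *)
Lemma form_rotate (r : nat) (beta : R) :
  form r beta = cos beta * form r 0 + sin beta * form r (pi / 2).
Proof.
rewrite !pade_prim_delta !mulr_sumr -big_split /=; apply: eq_bigr => a _.
by rewrite subr0 sinBpihalf sinB; ring.
Qed.

(* [pade_prim_pi4_lt0] says that the cosine sum exceeds the sine sum, so rotating
   by [eps] moves the form away from 0, on the side of the sign [(-1) ^+ r]. *)
Lemma form_neq0 (r : nat) (eps : R) : 0 < eps < pi / 4 ->
  form r (- (-1) ^+ r * eps) != 0.
Proof.
move=> /andP[e0 e4]; have p0 := @pi_gt0 R.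
have q0 : 0 < sin (pi / 4) :> R by apply: sin_gt0_pihalf; lra.
have q1 : cos (pi / 4) = sin (pi / 4) :> R
  by rewrite -cosBpihalf (_ : pi / 4 - pi / 2 = - (pi / 4)) ?cosN //; field.
have := pade_prim_pi4_lt0 base_angle_bounds r; rewrite form_rotate q1 -mulrDr pmulr_rlt0 // => CS.
have /andP[S0 _] := pade_prim_delta_bounds base_angle_bounds r.
have se0 : 0 < sin eps by apply: sin_gt0_pihalf; lra.
(* For odd [r] the form is less than (cos eps - sin eps) [form r 0], where [form r 0 <= 0]. *)
have sce : sin eps < cos eps.
  by rewrite -cosBpihalf -cosN opprB ltr_cos ?in_itv /=; lra.
suff : 0 < (-1) ^+ r * form r (- (-1) ^+ r * eps).
  by apply: contraTneq => ->; rewrite mulr0 ltxx.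
rewrite form_rotate mulNr cosN sinN; move: S0 CS; set S := form r 0; set C := form r _.
rewrite -signr_odd; case: odd; rewrite ?expr0 ?expr1 ?mul1r ?mulN1r ?sinN ?cosN ?opprK => S0 CS; nra.
Qed.

(** The scaled form is the imaginary part of a Gaussian integer: each angle splits into (4 r - 8 a)
    delta, handled by [gaussian_term], and delta - beta, covered by the hypothesis. *)
Lemma form_ge1 (r : nat) (beta s N : R) :
  (forall a, (a <= r)%N -> exists k : nat, N * pade R r a = k%:R) ->
  gaussian (sqrt2%:C%C * omega8 ^+ r * (s%:C%C * cis (base_angle - beta))) ->
  sqrt2 * 169 ^+ r * s * N * form r beta != 0 ->
  1 <= `|sqrt2 * 169 ^+ r * s * N * form r beta|.
Proof.
move=> HN gy; pose z : R[i] := \sum_(a < r.+1) (N * pade R r a)%:C%C *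
  ((sqrt2 * 169 ^+ r)%:C%C * (cis ((4 * r%:R - 8 * a%:R) * base_angle) *
    (s%:C%C * cis (base_angle - beta)))).
have gz : gaussian z.
  apply: gaussian_sum => a; have ar : (a <= r)%N by rewrite -ltnS.
  have [k ->] := HN a ar; apply: gaussianM; first exact: gaussian_nat.
  exact: gaussian_term.
suff <- : complex.Im z = sqrt2 * 169 ^+ r * s * N * form r beta by exact: norm_Im_gaussian.
rewrite /z raddf_sum pade_prim_delta mulr_sumr; apply: eq_bigr => a _.
rewrite -[LHS]/(complex.Im _) !Im_real_mul [X in complex.Im X]mulrCA Im_real_mul -cisD.
rewrite -[complex.Im (cis _)]/(sin _).
have -> : (4 * r%:R - 8 * a%:R) * base_angle + (base_angle - beta) =
  (4 * r%:R - 8 * a%:R + 1) * base_angle - beta by ring.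
by ring.
Qed.

(** As 239 ^ 2 = 2 * 169 ^ 2 - 1, the left side is about 1 / (338 * 169), and 42 * 8 = 336. The
    factors 8 and 169 will absorb the bound on [N] and the scaling by [169 ^+ r]. *)
Lemma cos_base_angle : 2 - 2 * cos (4 * base_angle) <= (42 * 8 * 169)^-1 :> R.
Proof.
have E := congr1 (@complex.Re R) cis_base_angle.
rewrite Re_real_mul /= in E; have s2 := sqrt2_sqr; have s0 := sqrt2_gt0.
move: E; set c := cos _ => E.
have c0 : 0 < c by nra.
have c2 : 2 * 169 ^+ 2 * c ^+ 2 = 239 ^+ 2.
  transitivity ((169 * sqrt2 * c) ^+ 2); last by rewrite E.
  by rewrite !exprMn s2; ring.
suff : 1 - (42 * 8 * 169)^-1 / 2 <= c by lra.
rewrite leNgt; apply/negP => cl; nra.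
Qed.

(** In [form_rotate] the sine sum is bounded by the integral, with delta <= 1 / 2, and the cosine
    sum by the sum of its coefficients. *)
Lemma form_le (r : nat) (beta N : R) : 0 < N <= 8 ^+ r ->
  (forall a, (a <= r)%N -> exists k : nat, N * pade R r a = k%:R) ->
  \sum_(a < r.+1) N * pade R r a <= 2 * 32 ^+ r ->
  N * `|form r beta| <= 8 ^+ r * ((42 * 8 * 169)^-1 ^+ r / 2) + `|sin beta| * (2 * 32 ^+ r).
Proof.
move=> /andP[N0 N8] HN HS.
have S : `|form r 0| <= (42 * 8 * 169)^-1 ^+ r / 2.
  have /andP[S0 S1] := pade_prim_delta_bounds base_angle_bounds r.
  have -> : `|form r 0| = (-1) ^+ r * form r 0.
    by rewrite -[RHS]ger0_norm // normrM normrX normrN1 expr1n mul1r.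
  have /andP[d0 d8] := base_angle_bounds; have := @pihalf_lt2 R => p2.
  have f0 : 0 <= 2 - 2 * cos (4 * base_angle) :> R by have := cos_le1 (4 * base_angle); lra.
  have fle := cos_base_angle.
  have K0 : 0 <= (42 * 8 * 169)^-1 :> R by rewrite invr_ge0 !mulr_ge0 ?ler0n.
  apply: (le_trans S1); rewrite mulrC; apply: ler_pM; [exact: exprn_ge0 | lra | | lra].
  by apply: lerXn2r; rewrite ?nnegrE.
have C : N * `|form r (pi / 2)| <= 2 * 32 ^+ r.
  apply: le_trans HS; rewrite -{1}(gtr0_norm N0) -normrM pade_prim_delta mulr_sumr.
  apply: (le_trans (ler_norm_sum _ _ _)); apply: ler_sum => a _.
  have [|k E] := HN a; first by rewrite -ltnS.
  by rewrite mulrA E normrM ger0_norm ?ler0n // ler_piMr ?ler0n ?sin_max.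
rewrite form_rotate; apply: (@le_trans _ _ (N * (`|form r 0| + `|sin beta| * `|form r (pi / 2)|))).
  rewrite ler_pM2l //; apply: (le_trans (ler_normD _ _)); rewrite !normrM lerD2r.
  by rewrite ler_piMl ?cos_max.
rewrite mulrDr mulrCA lerD //; last by rewrite ler_wpM2l.
by rewrite ler_pM // ltW.
Qed.

Lemma complex_fourth_power (a b : R) : ((a +i* b) ^+ 4)%C =
  ((a ^+ 4 - 6 * a ^+ 2 * b ^+ 2 + b ^+ 4) +i* (4 * (a ^+ 3 * b - a * b ^+ 3)))%C.
Proof. by apply/eqP; rewrite eq_complex /=; apply/andP; split; apply/eqP; ring. Qed.

(** * The approximation supplied by a solution *)

Section Solution.
Variables (x w : nat).
Hypothesis solution : (x ^ 2 + (x + 1) ^ 2 = w ^ 4)%N.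

Let X : R := (2 * x + 1)%:R.
Let eps : R := atan X^-1 / 4.
(** The modulus of z (3 - 2 i), whose factors have norms w and 13. *)
Let radius : R := Num.sqrt (13 * w)%:R.

Let w_gt0 : (0 < w)%N. Proof. by move: solution; nia. Qed.

Let X_gt0 : 0 < X. Proof. by rewrite ltr0n addn1. Qed.

Let sqrtX : Num.sqrt (X ^+ 2 + 1) = sqrt2 * w%:R ^+ 2.
Proof.
apply: (@pexpIrn _ 2) => //; rewrite ?nnegrE ?mulr_ge0 ?sqrtr_ge0 ?exprn_ge0 //.
have EX : X ^+ 2 + 1 = 2 * w%:R ^+ 4 by rewrite -!natrX -natrM natr1; congr _%:R; lia.
rewrite EX sqr_sqrtr ?mulr_ge0 ?exprn_ge0 // exprMn sqrt2_sqr; ring.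
Qed.

Lemma cis_eps : (sqrt2 * w%:R ^+ 2)%:C%C * cis (4 * eps) = (X +i* 1)%C.
Proof. by rewrite -sqrtX -cis_atan // /eps (_ : 4 * _ = atan X^-1) //; field. Qed.

Lemma cis_epsN : (sqrt2 * w%:R ^+ 2)%:C%C * cis (- (4 * eps)) = (X +i* -1)%C.
Proof.
have := cis_eps => /eqP; rewrite eq_complex /= => /andP[/eqP h1 /eqP h2].
apply/eqP; rewrite eq_complex /= cosN sinN; apply/andP; split; apply/eqP.
  by rewrite -[RHS]h1; ring.
by apply: oppr_inj; rewrite opprK -[RHS]h2; ring.
Qed.

Lemma radius_fourth : radius ^+ 4 = 169 * w%:R ^+ 2.
Proof.
by rewrite (exprM _ 2 2) sqr_sqrtr // natrM; ring.
Qed.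

Let two_neq0 : 2%:C%C != 0 :> R[i].
Proof. by rewrite eq_complex /= eqxx andbT pnatr_eq0. Qed.

Let conj_fourth : ((3 +i* -2) ^+ 4)%C = (-119 +i* -120)%C :> R[i].
Proof.
by rewrite complex_fourth_power; apply/eqP; rewrite eq_complex /=; apply/andP; split; apply/eqP; ring.
Qed.

Lemma gaussian_root : exists2 z : R[i], gaussian z &
  z ^+ 4 = if odd x then (- x%:R +i* (x%:R + 1))%C else ((x%:R + 1) +i* (- x%:R))%C.
Proof.
have [p [q [Ep Eq]]] := gaussian_fourth_root solution.
exists (p%:~R +i* q%:~R)%C; first exact: gaussian_int.
have := congr1 (fun z => z%:~R : R) Ep; have := congr1 (fun z => z%:~R : R) Eq.
rewrite complex_fourth_power !(rmorphD, rmorphN, rmorphM, rmorphXn) /= => -> ->.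
by case: odd; rewrite !(rmorphD, rmorphN).
Qed.

(** Its fourth power equals that of z (3 - 2 i): twice either one is (239 + i) (X - i). *)
Lemma gaussian_solution_odd : odd x ->
  gaussian (radius%:C%C * cis (base_angle - eps)).
Proof.
move=> ox; have [z gz] := gaussian_root; rewrite ox => Ez.
apply: (@gaussian_fourth_power _ _ (z * (3 +i* -2)%C)).
  by apply: gaussianM => //; exists 3, (-2).
rewrite !exprMn -rmorphXn /= radius_fourth -cisMn Ez conj_fourth; apply: (mulfI two_neq0).
transitivity ((239 +i* 1)%C * (X +i* -1)%C).
  rewrite -cis_base_angle -cis_epsN mulrACA -cisD mulrA -!rmorphM /=.
  congr (_%:C%C * cis _); last by ring.
  transitivity (sqrt2 ^+ 2 * (169 * w%:R ^+ 2)); last by ring.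
  by rewrite sqrt2_sqr.
rewrite /X natrD natrM; apply/eqP; rewrite eq_complex /=.
by apply/andP; split; apply/eqP; ring.
Qed.

(** The same comparison with (1 + i) z (3 - 2 i); both fourth powers are 2 (239 + i) (X + i). *)
Lemma gaussian_solution_even : ~~ odd x ->
  gaussian (sqrt2%:C%C * (radius%:C%C * cis (base_angle + eps))).
Proof.
move=> /negbTE ox; have [z gz] := gaussian_root; rewrite ox => Ez.
apply: (@gaussian_fourth_power _ _ ((1 +i* 1)%C * (z * (3 +i* -2)%C))).
  apply: gaussianM; first by exists 1, 1.
  by apply: gaussianM => //; exists 3, (-2).
have sqrt2_fourth : sqrt2 ^+ 4 = 4 by rewrite (exprM _ 2 2) sqrt2_sqr; ring.
rewrite !exprMn -!rmorphXn /= radius_fourth sqrt2_fourth -cisMn Ez conj_fourth.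
transitivity (2%:C%C * ((239 +i* 1)%C * (X +i* 1)%C)).
  rewrite -cis_base_angle -cis_eps mulrACA -cisD [LHS]mulrA [RHS]mulrA -!rmorphM /=.
  congr (_%:C%C * cis _); last by ring.
  transitivity (2 * (sqrt2 ^+ 2 * (169 * w%:R ^+ 2))); last by ring.
  by rewrite sqrt2_sqr; ring.
rewrite /X natrD natrM complex_fourth_power; apply/eqP; rewrite eq_complex /=.
by apply/andP; split; apply/eqP; ring.
Qed.

Lemma sin_eps_bounds : 0 < eps < pi / 4 /\ 0 < sin eps <= (sqrt2 * w%:R ^+ 2)^-1.
Proof.
have := @atan_ltpi2 R X^-1; have := @lt_atan R 0 X^-1; rewrite atan0 invr_gt0 => /(_ X_gt0).
have p0 := @pi_gt0 R.
move=> h1 h2; have e0 : 0 < eps < pi / 8 by rewrite /eps; lra.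
split; first by lra.
rewrite sin_gt0_pihalf /=; last by lra.
have s0 : 0 < sqrt2 * w%:R ^+ 2 by rewrite mulr_gt0 ?sqrt2_gt0 // exprn_gt0 // ltr0n.
have := congr1 (@complex.Im R) cis_eps; rewrite Im_real_mul /= => E.
have -> : (sqrt2 * w%:R ^+ 2)^-1 = sin (4 * eps).
  by rewrite -[LHS]mulr1 -[X in _ * X = _]E mulKf // gt_eqF.
by rewrite ltW // ltr_sin ?in_itv /=; lra.
Qed.

(** For odd [r], [sqrt2] times [omega8 ^+ r] is 1 + i times a power of i. For even [r],
    [omega8 ^+ r] is a power of i and [sqrt2] is the factor that even [x] requires. *)
Lemma gaussian_solution (r : nat) : odd r = odd x ->
  gaussian (sqrt2%:C%C * omega8 ^+ r * (radius%:C%C * cis (base_angle - (- (-1) ^+ r * eps)))).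
Proof.
move=> rx; have gw k : gaussian (omega8 ^+ k.*2).
  by rewrite -mul2n exprM omega8_sqr; apply: gaussianX; apply: gaussian_i.
rewrite -signr_odd rx -[r]odd_double_half rx exprD.
case: (boolP (odd x)) => ox.
  rewrite /= !expr1 opprK mul1r [_%:C%C * (_ * _)]mulrA sqrt2_omega8.
  apply: gaussianM; last exact: gaussian_solution_odd.
  by apply: gaussianM => //; exists 1, 1.
rewrite /= !expr0 mul1r mulN1r opprK mulrAC.
by apply: gaussianM => //; apply: gaussian_solution_even.
Qed.

Lemma solution_bound (r : nat) : odd r = odd x ->
  (26 * w < 1764 ^ r)%N -> (w ^ 3 < 208 * (169 * 32) ^ (2 * r))%N.
Proof.
move=> rx wr; rewrite ltnNge; apply/negP => wr3.
have [N N8 [HN HS]] := pade_sum_bounds r; have N0 : 0 < N by case/andP: N8.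
have [eb /andP[se0 se]] := sin_eps_bounds.
have s0 := sqrt2_gt0; have W0 : 0 < w%:R :> R by rewrite ltr0n.
have rad0 : 0 < radius by rewrite sqrtr_gt0 ltr0n muln_gt0.
pose beta := - (-1) ^+ r * eps.
have sbeta : `|sin beta| = sin eps.
  rewrite /beta -signr_odd; case: odd.
    by rewrite expr1 opprK mul1r gtr0_norm.
  by rewrite expr0 mulN1r sinN normrN gtr0_norm.
have := form_le beta N8 HN HS; have := form_ge1 HN (gaussian_solution rx).
rewrite -/beta sbeta => F1 F2.
have c0 : 0 < sqrt2 * 169 ^+ r * radius.
  by apply: mulr_gt0 => //; apply: mulr_gt0 => //; rewrite exprn_gt0 ?ltr0n.
have F3 : 1 <= sqrt2 * 169 ^+ r * radius * (N * `|form r beta|).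
  move: (sqrt2 * _ * _) c0 F1 => c c0 F1.
  have -> : c * (N * `|form r beta|) = `|c * N * form r beta|.
    by rewrite !normrM (gtr0_norm c0) (gtr0_norm N0) mulrA.
  by apply: F1; rewrite !mulf_neq0 ?form_neq0 // gt_eqF.
(* After cancellation this is sqrt (26 w) < 42 ^ r. *)
have F4 : sqrt2 * 169 ^+ r * radius * (8 ^+ r * ((42 * 8 * 169)^-1 ^+ r / 2)) < 1 / 2.
  have -> : sqrt2 * 169 ^+ r * radius * (8 ^+ r * ((42 * 8 * 169)^-1 ^+ r / 2)) =
      sqrt2 * radius / 42 ^+ r / 2.
    rewrite exprVn !exprMn; field.
    by rewrite !expf_neq0 ?pnatr_eq0.
  rewrite ltr_pM2r ?invr_gt0 // ltr_pdivrMr ?exprn_gt0 // mul1r.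
  rewrite -(@ltr_pXn2r _ 2) ?nnegrE ?mulr_ge0 ?exprn_ge0 // ?ltW //.
  rewrite exprMn sqrt2_sqr sqr_sqrtr // -!natrX -natrM ltr_nat.
  by rewrite -expnM [(r * 2)%N]mulnC expnM mulnA.
(* By the bound on sin eps it suffices that 4 [radius] 5408 ^ r <= w ^ 2; squared, this is [wr3]
   times w, as 208 = 16 * 13. *)
have F5 : sqrt2 * 169 ^+ r * radius * (sin eps * (2 * 32 ^+ r)) <= 1 / 2.
  have h : 4 * radius * (169 ^+ r * 32 ^+ r) <= w%:R ^+ 2.
    rewrite -(@ler_pXn2r _ 2) ?nnegrE ?mulr_ge0 ?exprn_ge0 ?(ltW rad0) ?ler0n //.
    rewrite !exprMn sqr_sqrtr // -!natrX -!natrM ler_nat.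
    apply: (@leq_trans (w * (208 * (169 * 32) ^ (2 * r)))%N); last first.
      by rewrite -expnD [(w ^ (2 + 2))%N]expnS leq_mul2l wr3 orbT.
    by rewrite [(2 * r)%N]mulnC expnM expnMn expnMn; apply: eq_leq; ring.
  apply: (@le_trans _ _ (sqrt2 * 169 ^+ r * radius * ((sqrt2 * w%:R ^+ 2)^-1 * (2 * 32 ^+ r)))).
    by rewrite ler_pM2l // ler_pM2r // mulr_gt0 ?exprn_gt0.
  have -> : sqrt2 * 169 ^+ r * radius * ((sqrt2 * w%:R ^+ 2)^-1 * (2 * 32 ^+ r)) =
     4 * radius * (169 ^+ r * 32 ^+ r) / w%:R ^+ 2 / 2.
    by field; rewrite !gt_eqF.
  by rewrite ler_pM2r ?invr_gt0 // ler_pdivrMr ?exprn_gt0 // mul1r.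
have F6 : sqrt2 * 169 ^+ r * radius * (N * `|form r beta|) <= sqrt2 * 169 ^+ r * radius *
   (8 ^+ r * ((42 * 8 * 169)^-1 ^+ r / 2) + sin eps * (2 * 32 ^+ r)) by rewrite ler_pM2l.
by rewrite mulrDr in F6; lra.
Qed.
End Solution.
End LinearForm.

(** * Choice of r and conclusion *)

Lemma no_large_solution (x w : nat) :
  x ^ 2 + (x + 1) ^ 2 = w ^ 4 -> ~~ (1764 ^ 11 <= 26 * w).
Proof.
move=> E; apply/negP => wL.
(* The exponent r runs through the parity class of [x]. For the least admissible r, failure at r - 2
   gives 26 w >= 1764 ^ (r - 2), and [power_gap] then contradicts [solution_bound]. *)
pose P t := 26 * w < 1764 ^ (2 * t + odd x).
have exP : exists t, P t.
  exists (26 * w); apply: (leq_trans (ltn_expl _ (isT : 1 < 1764))).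
  by apply: leq_pexp2l => //; lia.
case: (ex_minnP exP) => t Pt tmin.
have r12 : 11 < 2 * t + odd x by rewrite -(@ltn_exp2l 1764) //; apply: leq_ltn_trans Pt.
have [k Ek] : exists k, 2 * t + odd x = 12 + k by exists (2 * t + odd x - 12); lia.
have U : 1764 ^ (10 + k) <= 26 * w.
  have -> : 10 + k = 2 * t.-1 + odd x by lia.
  by rewrite leqNgt; apply/negP => /tmin; lia.
have rx : odd (12 + k) = odd x by rewrite -Ek; lia.
rewrite /P Ek in Pt.
have := solution_bound Rdefinitions.R E rx Pt; apply/negP; rewrite -leqNgt.
rewrite -(@leq_pmul2l (26 ^ 3)) ?expn_gt0 //; apply: (leq_trans (power_gap k)).
by rewrite mulnC expnM -expnMn leq_exp2r.
Qed.

Theorem theorem1 (x w : nat) :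
  x ^ 2 + (x + 1) ^ 2 = w ^ 4 <-> (x, w) = (0, 1) \/ (x, w) = (119, 13).
Proof.
split=> [E | [][-> ->]]; [ | by [] | by lia].
have small : x = 0 \/ x = 119.
  have [->|/eqP x0] := eqVneq x 0; first by left.
  have [->|/eqP x119] := eqVneq x 119; first by right.
  by have := no_large_solution E; rewrite (nontrivial_solution_large E x0 x119).
have inj w' : x ^ 2 + (x + 1) ^ 2 = w' ^ 4 -> w = w'.
  by rewrite E => /eqP; rewrite eqn_exp2r // => /eqP.
case: small => x0; [left | right]; congr pair => //; apply: inj; rewrite x0; lia.
Qed.
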